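(* Let $s_0>0$ and let $p,q:[s_0,+\infty)\to\mathbb{R}$ be continuous functions such that $p(s)\ge 0$ for all $s\ge s_0$ and $p,q\in L^1((s_0,+\infty),\mathbb{R})$. Assume that there exists an increasing sequence $(a_m)_{m\ge1}$ of numbers from $[s_0,+\infty)$, unbounded from above, such that for all $m\ge 1$ $$q(s)<0 \ \text{ for } s\in(a_{2m},a_{2m+1}),\qquad q(s)>0\ \text{ for } s\in(a_{2m+1},a_{2m+2}),$$ $$\int_{a_{2m}}^{a_{2m+1}}|q(s)|\,ds>3\int_{a_{2m+1}}^{a_{2m+2}}q(s)\,ds,\qquad \int_{a_{2m+1}}^{a_{2m+2}}q(s)\,ds>2\int_{a_{2m+2}}^{+\infty}|q(s)|\,ds.$$ Suppose also that, for all sufficiently large $m$, $$\int_{a_{2m}}^{a_{2m+1}}(s-a_{2m})|q(s)|\,ds>6\cdot\frac{a_{2m+1}^2}{a_{2m}}\int_{a_{2m+1}}^{+\infty}|q(s)|\,ds$$ and $$\int_{a_{2m+1}}^{a_{2m+2}}(s-a_{2m+1})q(s)\,ds>4\cdot\frac{a_{2m+2}^2}{a_{2m+1}}\int_{a_{2m+2}}^{+\infty}|q(s)|\,ds.$$ Define, for $s\ge s_0$, $$z(s)=\exp\left(-\int_{s_0}^{s}p(\tau)\,d\tau\right)\int_{s}^{+\infty}q(\tau)\exp\left(\int_{s_0}^{\tau}p(\xi)\,d\xi\right)d\tau,\qquad h(s)=-s\int_s^{+\infty}\frac{z(\tau)}{\tau^2}\,d\tau.$$ Then $h$ is an oscillatory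 solution of the differential equation $$h''+p(s)\left(h'-\frac{h}{s}\right)+\frac{q(s)}{s}=0,\qquad s\ge s_0,$$ and $\lim_{s\to+\infty}h(s)=0$.
   Context: ''Increasing'' means strictly increasing. A continuous function on $[s_0,+\infty)$ is called oscillatory if it takes both positive and negative values at arbitrarily large arguments (so that it has arbitrarily large zeros at which it changes sign). A solution of the second order equation is a twice continuously differentiable function satisfying it on $[s_0,+\infty)$ (one-sided derivatives at $s_0$). *)

(* Defs.v *)
From HB Require Import structures.
From mathcomp Require Import all_boot all_order all_algebra.
From mathcomp Require Import all_classical all_reals all_analysis.

Set Implicit Arguments.
Unset Strict Implicit.
Unset Printing Implicit Defensive.

Import Order.TTheory GRing.Theory Num.Theory.
Import numFieldNormedType.Exports.

Local Open Scope classical_set_scope.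
Local Open Scope ring_scope.

(* Functions on [s0, +oo) are represented by total functions R -> R of which
   only the values on `[s0, +oo[ matter. *)

(* [l] is the derivative at [x] of the restriction of [f] to [D]: the usual
   derivative if [x] is interior to [D], the right derivative if [x = s0] and
   [D = `[s0, +oo[]. *)
Definition has_derivative_within (R : realType) (D : set R) (f : R -> R)
    (x l : R) : Prop :=
  (f t - f x) / (t - x) @[t --> within D x^'] --> l.

(* On [D = `[s0, +oo[] the functions [h1 = h'] and [h2 = h''] are unique. *)
Definition is_solution (R : realType) (s0 : R) (p q h : R -> R) : Prop :=
  exists h1 h2 : R -> R,
    [/\ forall s, s0 <= s -> has_derivative_within `[s0, +oo[ h s (h1 s),
        forall s, s0 <= s -> has_derivative_within `[s0, +oo[ h1 s (h2 s),
        {within `[s0, +oo[, continuous h2} &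
        forall s, s0 <= s ->
          h2 s + p s * (h1 s - h s / s) + q s / s = 0].

Definition oscillatory (R : realType) (s0 : R) (h : R -> R) : Prop :=
  {within `[s0, +oo[, continuous h} /\
  forall M : R,
    (exists s, [/\ s0 <= s, M < s & 0 < h s]) /\
    (exists s, [/\ s0 <= s, M < s & h s < 0]).

(* Main.v *)
Require Import Defs.
From HB Require Import structures.
From mathcomp Require Import all_boot all_order all_algebra.
From mathcomp Require Import all_classical all_reals all_analysis.
From mathcomp Require Import measurable_realfun ring lra.

Import Order.TTheory GRing.Theory Num.Theory.
Import numFieldNormedType.Exports.

Local Open Scope classical_set_scope.
Local Open Scope ring_scope.

(** One has [z' = - p z - q], hence [h' - h / s = z / s] and [h'' = - (p z + q) / s],
    which is the equation.  Since [|z s| <= C * T s] with [T s] the integral of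
    [|q|] over [[s, +oo[], also [|h s| <= C * T s], which tends to [0].

    Oscillation: let [q] have constant sign on an interval [(al, be)] of the
    sequence, and let [k] bound the integrating factor (which tends to [1]).  On
    [[al, be]] the function [z] is of the sign [e] of [q] up to an error [k * T be]:
    [e * z s >= T s - T be - k * T be].  Integrating [e * z / t^2] by
    parts over [[al, be]] gives at least the first moment of [|q|] divided by
    [be^2], while the errors and the tail beyond [be] contribute at most
    [k * T be / al].  The moment hypotheses make the former dominate, so [h al]
    has the sign opposite to [q].

    To avoid one-sided derivatives at [s0], [p] and [q] are extended to the whole
    line by their value at [s0], and every integral is expressed through the
    differentiable functions [s |-> tail f s]. *)

(** * Calculus of tail integrals *)

Section tail.
Context {R : realType}.
Notation mu := (@lebesgue_measure R).
Implicit Types f g : R -> R.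

Definition tail f (s : R) : R := \int[mu]_(t in `[s, +oo[) f t.

(** All real [s] are allowed, not only [s >= s0], so that for continuous [f] the function [tail f]
    has two-sided derivatives everywhere, [s0] included. *)
Definition tail_integrable f := forall s : R, mu.-integrable `[s, +oo[ (EFin \o f).

Lemma continuous_integrable_itvcc f (a b : R) : continuous f ->
  mu.-integrable `[a, b] (EFin \o f).
Proof.
move=> cf; apply: continuous_compact_integrable; first exact: segment_compact.
exact: continuous_subspaceT.
Qed.

(** A continuous function is integrable on the compact [[s, b]], which together with []b, +oo[]
    covers [[s, +oo[]. *)
Lemma tail_integrable_obnd f (b : R) : continuous f ->
  mu.-integrable `]b, +oo[ (EFin \o f) -> tail_integrable f.
Proof.
move=> cf intf s.
have mf : measurable_fun setT f by exact: continuous_measurable_fun.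
apply/integrableP; split; first exact/measurable_EFinP/measurable_funTS.
apply: (@le_lt_trans _ _ (\int[mu]_(x in `[s, b] `|` `]b, +oo[) `|(EFin \o f) x|)%E).
  apply: ge0_subset_integral => //=; first exact: measurableU.
    by do 2 apply: measurableT_comp => //; exact: measurable_funTS.
  move=> x /=; rewrite !in_itv/= !andbT => sx.
  by case: (leP x b) => xb; [left|right]; rewrite ?sx.
rewrite ge0_integral_setU//=.
- apply: lte_add_pinfty.
    by have /integrableP[] := continuous_integrable_itvcc _ s b cf.
  by have /integrableP[] := intf.
- by do 2 apply: measurableT_comp => //; exact: measurable_funTS.
- apply/disj_setPS => x [] /=; rewrite !in_itv/= andbT => /andP[_ xb].
  by rewrite ltNge xb.
Qed.

Lemma le_tail_integrable f g : continuous f -> (forall x, `|f x| <= `|g x|) ->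
  tail_integrable g -> tail_integrable f.
Proof.
move=> cf fg ig s; apply: le_integrable (ig s) => //.
- by apply/measurable_EFinP; apply: measurable_funTS; exact: continuous_measurable_fun.
- by move=> x _ /=; rewrite lee_fin.
Qed.

Lemma tailB f (a b : R) : tail_integrable f -> a <= b ->
  tail f a - tail f b = \int[mu]_(t in `[a, b]) f t.
Proof.
move=> intf ab; rewrite /tail.
have bS : `]b, +oo[ `<=` `[b, +oo[ by apply: subset_itvr; rewrite bnd_simp.
rewrite -[X in _ - X]Rintegral_itv_obnd_cbnd; last exact: integrableS (intf b).
rewrite -(@Rintegral_itvB _ _ (BLeft a))//.
by rewrite opprB addrC subrK.
Qed.

Lemma is_derive_integral f (a x : R) : continuous f -> a < x ->
  is_derive x 1 (fun y => \int[mu]_(t in `[a, y]) f t) (f x).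
Proof.
move=> cf ax.
have [||||dF <-] := @continuous_FTC1 _ f (BLeft a) x (x + 1).
- by rewrite ltrDl.
- exact: continuous_integrable_itvcc.
- by rewrite lte_fin.
- exact: cf.
by rewrite derive1E; exact: derivableP.
Qed.

(** Near [x], [tail f] is a constant minus the integral from the fixed base point [x - 1], so the
    fundamental theorem on a compact interval applies. *)
Lemma is_derive_tail f (x : R) : continuous f -> tail_integrable f ->
  is_derive x 1 (tail f) (- f x).
Proof.
move=> cf intf.
have x1 : x - 1 < x by rewrite gtrBl.
apply: (@near_eq_is_derive _ _ _
  (fun y => tail f (x - 1) - \int[mu]_(t in `[x - 1, y]) f t)).
  near=> y; rewrite -tailB//; first by rewrite opprB addrC subrK.
  by apply: ltW; near: y; exact: lt_nbhsr.
rewrite -[X in is_derive _ _ _ X]add0r.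
exact: (is_deriveB (is_derive_cst _ _ _) (is_derive_integral _ _ _ cf x1)).
Unshelve. all: by end_near. Qed.

Lemma is_derive_continuous f (x df : R) : is_derive x 1 f df -> {for x, continuous f}.
Proof.
by move=> [dfx _]; apply/differentiable_continuous/derivable1_diffP.
Qed.

Lemma tail_continuous f : continuous f -> tail_integrable f -> continuous (tail f).
Proof.
by move=> cf intf x; exact: is_derive_continuous _ _ _ (is_derive_tail f x cf intf).
Qed.

(** Along a sequence [u] tending to [+oo], the truncations of [f] to [[u n, +oo[] tend to 0
    pointwise and are dominated by [|f|]. *)
Lemma tail_cvg0 f : tail_integrable f -> tail f s @[s --> +oo] --> (0 : R).
Proof.
move=> intf; apply/cvg_pinftyP => u uoo.
have /integrableP[mf _] := intf 0.
have [|||||_ _] := @dominated_convergence _ _ R mu _ (measurable_itv `[0, +oo[)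
    (fun n => (EFin \o f) \_ `[u n, +oo[) (cst 0%E) (abse \o (EFin \o f)).
- move=> n; apply/measurable_restrict => //.
  exact: measurable_funS mf.
- by [].
- apply: aeW => x _; apply: cvg_near_cst; near=> n.
  rewrite patchE memNset//= in_itv/= andbT; apply/negP; rewrite -ltNge.
  rewrite (@lt_le_trans _ _ (x + 1)) ?ltrDl//; near: n.
  by move/cvgryPge : uoo; exact.
- exact: integrable_abse.
- by apply: aeW => x n _; rewrite patchE; case: ifP => _ /=;
    rewrite ?lexx ?normr0 ?lee_fin.
rewrite integral0 => /fine_cvgP[_]; apply: cvg_trans.
apply: near_eq_cvg; near=> n; rewrite /= -integral_mkcondr setIidr//.
apply: subset_itvr; rewrite bnd_simp.
by near: n; move/cvgryPge : uoo; exact.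
Unshelve. all: by end_near. Qed.

(** By the mean value theorem; the derivative is tested only in the open interval because the sign
    of [q] is known only there. *)
Lemma is_derive_ge0_le f (df : R -> R) (a b : R) : a <= b ->
  (forall x : R, a <= x <= b -> is_derive x 1 f (df x)) ->
  (forall x : R, a < x < b -> 0 <= df x) -> f a <= f b.
Proof.
rewrite le_eqVlt => /predU1P[->//|ab] dff df0; rewrite -subr_ge0.
have [||c] := @MVT _ f df a b ab.
- by move=> x /[!in_itv]/= /andP[ax xb]; apply: dff; rewrite !ltW.
- apply: continuous_in_subspaceT => x /[!inE]/= /[!in_itv]/= axb.
  exact: is_derive_continuous (dff x axb).
rewrite in_itv/= => cab ->.
by rewrite mulr_ge0 ?df0// subr_ge0 ltW.
Qed.

Lemma tail_ge0 f (s : R) : (forall t, 0 <= f t) -> 0 <= tail f s.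
Proof. by move=> f0; exact: Rintegral_ge0. Qed.

Lemma tail_le f (s t : R) : (forall t, 0 <= f t) -> tail_integrable f -> s <= t ->
  tail f t <= tail f s.
Proof. by move=> f0 intf st; rewrite -subr_ge0 tailB// Rintegral_ge0. Qed.

Lemma norm_tail_le f g (s : R) : tail_integrable f -> tail_integrable g ->
  (forall t, s <= t -> `|f t| <= g t) -> `|tail f s| <= tail g s.
Proof.
move=> intf intg fg.
apply: le_trans (le_normr_Rintegral _ (intf s)) _ => //.
apply: le_Rintegral => //; first exact: integrable_norm (intf s).
- by move=> x /=; rewrite in_itv/= andbT; exact: fg.
Qed.

Lemma tailZ f (k s : R) : tail_integrable f ->
  tail (fun t => k * f t) s = k * tail f s.
Proof. by move=> intf; rewrite /tail RintegralZl//; exact: (intf s). Qed.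

Lemma is_derive_inv (x : R) : x != 0 -> is_derive x 1 (fun t : R => t^-1) (- x ^- 2).
Proof.
move=> x0; apply: is_derive_eq (is_deriveV x0 (is_derive_id _ _)) _.
by rewrite scaler1.
Qed.

End tail.

(** * The inverse-square weight on the whole line *)

Section inverse_square.
Context {R : realType} (s0 : R) (s0_gt0 : 0 < s0).
Notation mu := (@lebesgue_measure R).

(** Freezing [t] below [s0] keeps the weight [t ^- 2] continuous across 0, as the whole-line lemmas
    require. *)
Definition inv_sqr_max (t : R) : R := (Num.max s0 t) ^- 2.

Let max_gt0 t : 0 < Num.max s0 t. Proof. by rewrite lt_max s0_gt0. Qed.

Lemma inv_sqr_max_ge0 t : 0 <= inv_sqr_max t.
Proof. by rewrite invr_ge0 exprn_ge0// ltW. Qed.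

Lemma inv_sqr_maxE t : s0 <= t -> inv_sqr_max t = t ^- 2.
Proof. by rewrite /inv_sqr_max => /max_idPr ->. Qed.

Lemma continuous_inv_sqr_max : continuous inv_sqr_max.
Proof.
move=> x; apply: cvgV; first by rewrite expf_neq0// gt_eqF.
have cm : {for x, continuous (cst s0 \max id)}.
  by apply: continuous_max; [exact: cvg_cst|exact: cvg_id].
by apply: cvgM; exact: cm.
Qed.

Let ftc (s : R) : s0 <= s ->
  (\int[mu]_(x in `[s, +oo[) (inv_sqr_max x)%:E)%E = (s^-1)%:E.
Proof.
move=> s0s; have sgt0 : 0 < s by exact: lt_le_trans s0s.
rewrite (@ge0_continuous_FTC2y _ _ (fun t => - t^-1) s 0).
- by rewrite sub0e EFinN oppeK.
- by move=> x _; exact: inv_sqr_max_ge0.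
- exact/continuous_subspaceT/continuous_inv_sqr_max.
- rewrite -oppr0; apply: cvgN; apply/gtr0_cvgV0; first exact: nbhs_pinfty_gt.
  exact: cvg_id.
- move=> x sx; have := is_deriveN (is_derive_inv x _).
  by case; first by rewrite gt_eqF// (lt_trans sgt0).
- apply: cvgN; apply: cvgV; first by rewrite gt_eqF.
  exact: cvg_at_right_filter.
- move=> x /[!in_itv]/= /andP[sx _]; rewrite derive1E.
  have x0 : x != 0 by rewrite gt_eqF// (lt_trans sgt0).
  rewrite (@derive_val _ _ _ _ _ _ _ (is_deriveN (is_derive_inv x x0))) opprK.
  by rewrite inv_sqr_maxE// ltW// (le_lt_trans s0s).
Qed.

Lemma tail_integrable_inv_sqr_max : tail_integrable inv_sqr_max.
Proof.
apply: (@tail_integrable_obnd _ _ s0); first exact: continuous_inv_sqr_max.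
suff: mu.-integrable `[s0, +oo[ (EFin \o inv_sqr_max).
  by apply: integrableS => //; apply: subset_itvr; rewrite bnd_simp.
apply/integrableP; split.
  apply/measurable_EFinP; apply: measurable_funTS.
  by apply: continuous_measurable_fun; exact: continuous_inv_sqr_max.
under eq_integral do rewrite /= ger0_norm ?inv_sqr_max_ge0//.
by rewrite ftc// ltry.
Qed.

Lemma tail_inv_sqr_max s : s0 <= s -> tail inv_sqr_max s = s^-1.
Proof. by move=> s0s; rewrite /tail /Rintegral ftc. Qed.

End inverse_square.

(** * The solution, its decay, and its sign at the left end of an interval *)

Section solution.
Context {R : realType} (p q : R -> R) (s0 : R).
Context (s0_gt0 : 0 < s0) (p_ge0 : forall s, 0 <= p s).
Context (cp : continuous p) (cq : continuous q).
Context (ip : tail_integrable p) (iq : tail_integrable q).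
Notation mu := (@lebesgue_measure R).

Let A := tail p.
Let T := tail (fun t => `|q t|).

(* The integrating factor is normalised to [1] at [+oo] instead of [s0]. *)
Definition weighted_q (t : R) : R := q t * expR (- tail p t).
Definition z_sol (s : R) : R := expR (tail p s) * tail weighted_q s.
Definition w_sol (t : R) : R := z_sol t * inv_sqr_max s0 t.
Definition h_sol (s : R) : R := - s * tail w_sol s.

Let cnq : continuous (fun t => `|q t|).
Proof. by move=> x; apply: cvg_norm; exact: cq. Qed.

Let inq : tail_integrable (fun t => `|q t|).
Proof. by move=> s; exact: integrable_norm (iq s). Qed.

Let dA (x : R) : is_derive x 1 A (- p x). Proof. exact: is_derive_tail. Qed.

Let dT (x : R) : is_derive x 1 T (- `|q x|).
Proof. exact: (@is_derive_tail _ (fun t => `|q t|)). Qed.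

Let A_ge0 s : 0 <= A s. Proof. exact: tail_ge0. Qed.

Let A_le s t : s <= t -> A t <= A s. Proof. exact: tail_le. Qed.

Let T_ge0 s : 0 <= T s. Proof. exact: tail_ge0. Qed.

Let T_le s t : s <= t -> T t <= T s. Proof. exact: tail_le. Qed.

Let norm_weighted_q t : `|weighted_q t| <= `|q t|.
Proof.
rewrite normrM ler_piMr// ger0_norm ?expR_ge0// -expR0 ler_expR oppr_le0.
exact: A_ge0.
Qed.

Lemma continuous_weighted_q : continuous weighted_q.
Proof.
move=> x; apply: cvgM; first exact: cq.
apply: continuous_cvg; first exact: continuous_expR.
by apply: cvgN; exact: tail_continuous.
Qed.

Lemma tail_integrable_weighted_q : tail_integrable weighted_q.
Proof. exact: (le_tail_integrable _ q continuous_weighted_q). Qed.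

Lemma norm_tail_weighted_q s : `|tail weighted_q s| <= T s.
Proof.
apply: norm_tail_le => //; exact: tail_integrable_weighted_q.
Qed.

(** In the product rule the weights [expR (A x)] and [expR (- A x)] cancel, which leaves [q x]
    itself. *)
Lemma is_derive_z_sol (x : R) : is_derive x 1 z_sol (- (p x * z_sol x + q x)).
Proof.
have dV : is_derive x 1 (tail weighted_q) (- weighted_q x).
  apply: is_derive_tail; first exact: continuous_weighted_q.
  exact: tail_integrable_weighted_q.
have dE := is_derive1_comp (is_derive_expR (A x)) (dA x).
apply: is_derive_eq (is_deriveM dE dV) _.
have E1 : expR (tail p x) * expR (- tail p x) = 1 by rewrite -expRD subrr expR0.
rewrite /weighted_q /z_sol /GRing.scale/= /A.
rewrite -[X in _ = - (_ + X)]mulr1 -E1.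
by ring.
Qed.

Lemma continuous_z_sol : continuous z_sol.
Proof. by move=> x; exact: is_derive_continuous (is_derive_z_sol x). Qed.

Lemma norm_z_sol s t : s <= t -> `|z_sol t| <= expR (A s) * T s.
Proof.
move=> st; rewrite normrM ger0_norm ?expR_ge0//.
apply: ler_pM; rewrite ?expR_ge0 ?ler_expR ?A_le//.
exact: le_trans (norm_tail_weighted_q _) (T_le _ _ st).
Qed.

Lemma continuous_w_sol : continuous w_sol.
Proof.
move=> x; apply: cvgM; first exact: continuous_z_sol.
exact: continuous_inv_sqr_max.
Qed.

Let norm_w_sol s t : s <= t -> `|w_sol t| <= expR (A s) * T s * inv_sqr_max s0 t.
Proof.
move=> st; rewrite normrM [X in _ * X]ger0_norm ?inv_sqr_max_ge0//.
by rewrite ler_wpM2r ?inv_sqr_max_ge0// norm_z_sol.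
Qed.

Let int_bound k : tail_integrable (fun t => k * inv_sqr_max s0 t).
Proof.
move=> s.
exact: (@integrableZl _ _ _ mu _ (measurable_itv _) k _
  (tail_integrable_inv_sqr_max _ s0_gt0 s)).
Qed.

Lemma tail_integrable_w_sol : tail_integrable w_sol.
Proof.
apply: (@tail_integrable_obnd _ _ s0); first exact: continuous_w_sol.
have ib : mu.-integrable `]s0, +oo[
    (EFin \o (fun t => expR (A s0) * T s0 * inv_sqr_max s0 t)).
  by apply: integrableS (int_bound _ s0) => //; apply: subset_itvr; rewrite bnd_simp.
apply: le_integrable ib => //.
- apply/measurable_EFinP; apply: measurable_funTS.
  by apply: continuous_measurable_fun; exact: continuous_w_sol.
- move=> x /=; rewrite in_itv/= andbT lee_fin => /ltW s0x.
  by rewrite (le_trans (norm_w_sol _ _ s0x))// ler_norm.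
Qed.

(** On [[s, +oo[] the bound on [z_sol] is constant, so only the integral [s^-1] of the weight
    remains; it later cancels the factor [s] of [h_sol]. *)
Lemma norm_tail_w_sol s : s0 <= s -> `|tail w_sol s| <= expR (A s) * T s / s.
Proof.
move=> s0s; rewrite -(@tail_inv_sqr_max _ s0)// -tailZ; last first.
  exact: tail_integrable_inv_sqr_max.
apply: norm_tail_le; [exact: tail_integrable_w_sol|exact: int_bound|].
exact: norm_w_sol.
Qed.

Let dW (x : R) : is_derive x 1 (tail w_sol) (- w_sol x).
Proof.
apply: is_derive_tail; first exact: continuous_w_sol.
exact: tail_integrable_w_sol.
Qed.

Lemma is_derive_h_sol (x : R) : is_derive x 1 h_sol (- tail w_sol x + x * w_sol x).
Proof.
apply: is_derive_eq (is_deriveM (is_deriveNid _ _) (dW x)) _.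
by rewrite /GRing.scale/=; ring.
Qed.

Lemma cvg_h_sol : h_sol s @[s --> +oo] --> (0 : R).
Proof.
(* With the exponential frozen at [s0], the only varying factor of the majorant of [|h_sol s|] is
   [T s]. *)
have T0 : expR (A s0) * T s @[s --> +oo] --> (0 : R).
  rewrite -[X in _ --> X](mulr0 (expR (A s0))); exact: cvgM (cvg_cst _) (tail_cvg0 _ inq).
apply/norm_cvg0P; apply: (squeeze_cvgr _ (cvg_cst 0) T0).
near=> s; have s0s : s0 <= s by near: s; apply: nbhs_pinfty_ge; exact: num_real.
have s_gt0 : 0 < s by exact: lt_le_trans s0s.
rewrite normr_ge0/= normrM normrN (gtr0_norm s_gt0) mulrC -ler_pdivlMr//.
apply: le_trans (norm_tail_w_sol _ s0s) _.
rewrite ler_pM2r ?invr_gt0// ler_wpM2r// ler_expR; exact: A_le.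
Unshelve. all: by end_near. Qed.

(* [sg = 1] on the intervals where [q < 0], [sg = -1] where [q > 0]. *)
Lemma sg_tail_w_sol_lt0 (sg k al be : R) : `|sg| = 1 ->
  s0 <= al -> al < be -> expR (A al) <= k ->
  (forall s, al < s < be -> `|q s| = - (sg * q s)) ->
  k * (be ^+ 2 / al) * T be < \int[mu]_(s in `[al, be]) ((s - al) * `|q s|) ->
  sg * tail w_sol al < 0.
Proof.
move=> sg1 s0al albe kA qsg.
set m : R -> R := fun s => (s - al) * `|q s|.
have al_gt0 : 0 < al by exact: lt_le_trans s0al.
have be_gt0 : 0 < be by exact: lt_trans albe.
have z_le s : al <= s <= be -> sg * z_sol s <= k * T be - (T s - T be).
  move=> /andP[als sbe].
  (* Freezing the weight [expR (- A s)] at the left end turns the derivative into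
     [|q x| * (expR (- A x) - expR (- A s))], which is nonnegative since [A] is nonincreasing.
     Comparing the values at [s] and [be], then multiplying by [expR (A s)], bounds
     [sg * z_sol s]. *)
  have dF (x : R) : is_derive x 1
      (fun u => sg * tail weighted_q u + expR (- A s) * T u)
      (sg * - weighted_q x + expR (- A s) * - `|q x|).
    apply: is_deriveD; apply: is_deriveZ; last exact: dT.
    apply: is_derive_tail; first exact: continuous_weighted_q.
    exact: tail_integrable_weighted_q.
  have /= := @is_derive_ge0_le _ _ _ s be sbe (fun x _ => dF x).
  have -> : sg * z_sol s =
      expR (A s) * (sg * tail weighted_q s + expR (- A s) * T s) - T s.
    rewrite mulrDr !mulrA -expRD subrr expR0 mul1r addrK /z_sol.
    by rewrite -/(A s); ring.
  move=> Fle.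
  have {}Fle : sg * tail weighted_q s + expR (- A s) * T s <=
      sg * tail weighted_q be + expR (- A s) * T be.
    apply: Fle => x /andP[sx xbe].
    have := qsg x; rewrite (le_lt_trans als sx) xbe => /(_ isT) qx.
    have -> : sg * - weighted_q x + expR (- A s) * - `|q x| =
        `|q x| * (expR (- A x) - expR (- A s)).
      by rewrite qx /weighted_q -/(A x); ring.
    by rewrite mulr_ge0// subr_ge0 ler_expR lerN2; apply: A_le; rewrite ltW.
  have H1 : expR (A s) * (sg * tail weighted_q s + expR (- A s) * T s) <=
      expR (A s) * (sg * tail weighted_q be) + T be.
    apply: le_trans (ler_wpM2l (expR_ge0 _) Fle) _.
    by rewrite mulrDr (mulrA _ (expR _)) -expRD subrr expR0 mul1r.
  have H2 : expR (A s) * (sg * tail weighted_q be) <= k * T be.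
    apply: (@le_trans _ _ (expR (A s) * T be)).
      rewrite ler_wpM2l ?expR_ge0//; apply: le_trans (ler_norm _) _.
      by rewrite normrM sg1 mul1r norm_tail_weighted_q.
    rewrite ler_wpM2r//; apply: le_trans kA; rewrite ler_expR; exact: A_le.
  by rewrite opprB addrA lerD2r (le_trans H1)// lerD2r.
have cm : continuous m.
  move=> x; apply: cvgM; last exact: cnq.
  by apply: cvgB; [exact: cvg_id|exact: cvg_cst].
(* The base point [al - 1] gives [M] a two-sided derivative at [al]. *)
pose M s := \int[mu]_(t in `[al - 1, s]) m t.
have dM (x : R) : al <= x -> is_derive x 1 M (m x).
  by move=> alx; apply: is_derive_integral => //; rewrite ltrBlDr ltr_pwDr.
have im a b : mu.-integrable `[a, b] (EFin \o m).
  exact: continuous_integrable_itvcc.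
have ME : M be - M al = \int[mu]_(s in `[al, be]) m s.
  rewrite /M (@Rintegral_itvB _ m (BLeft (al - 1)) (BRight be) al).
  - rewrite Rintegral_itv_obnd_cbnd//; apply: integrableS (im al be) => //.
    by apply: subset_itvr; rewrite bnd_simp.
  - exact: im.
  - by rewrite bnd_simp gerBl.
  - by rewrite bnd_simp ltW.
(* This encodes the integration by parts: [M s + (s - al) * (T s - T be)] has derivative
   [T s - T be], and its product term vanishes at both ends, so its increment is the moment. The
   [s^-1] term accounts for the error [k * T be / x ^+ 2]. *)
have dPsi (x : R) : al <= x <= be -> is_derive x 1
    (fun s => sg * tail w_sol s - be ^- 2 * (M s + (s - al) * (T s - T be))
      - k * T be * s^-1)
    (sg * - w_sol x - be ^- 2 * (m x + ((x - al) * - `|q x| + (T x - T be)))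
      - k * T be * - x ^- 2).
  move=> /andP[alx _].
  have x0 : x != 0 by rewrite gt_eqF// (lt_le_trans al_gt0).
  apply: is_deriveB; last exact: is_deriveZ (is_derive_inv x x0).
  apply: is_deriveB; first exact: is_deriveZ.
  apply: is_deriveZ; apply: is_deriveD; first exact: dM.
  have d1 : is_derive x 1 (fun s : R => s - al) 1.
    rewrite -[X in is_derive _ _ _ X]subr0.
    exact: (is_deriveB (is_derive_id _ _) (is_derive_cst _ _ _)).
  have d2 : is_derive x 1 (fun s : R => T s - T be) (- `|q x|).
    rewrite -[X in is_derive _ _ _ X]subr0.
    exact: (is_deriveB (dT _) (is_derive_cst _ _ _)).
  apply: is_derive_eq (is_deriveM d1 d2) _.
  by rewrite /GRing.scale/= mulr1.
have Psi_le := is_derive_ge0_le _ _ _ _ (ltW albe) dPsi.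
rewrite -ME => lt_moment.
have Wbe : sg * tail w_sol be <= k * T be / be.
  apply: le_trans (ler_norm _) _; rewrite normrM sg1 mul1r.
  have s0be : s0 <= be by rewrite (le_trans s0al)// ltW.
  apply: le_trans (norm_tail_w_sol _ s0be) _.
  rewrite ler_pM2r ?invr_gt0// ler_wpM2r//; apply: le_trans kA.
  by rewrite ler_expR A_le// ltW.
have {}Psi_le : sg * tail w_sol al - be ^- 2 * M al - k * T be / al <=
    sg * tail w_sol be - be ^- 2 * M be - k * T be / be.
  move: Psi_le; rewrite !subrr !(mulr0,mul0r,addr0); apply.
  move=> x /andP[alx xbe].
  have x_gt0 : 0 < x by exact: lt_trans alx.
  have zx : sg * z_sol x <= k * T be - (T x - T be) by apply: z_le; rewrite !ltW.
  have -> : sg * - w_sol x - be ^- 2 * (m x + ((x - al) * - `|q x| + (T x - T be)))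
      - k * T be * - x ^- 2 =
      (k * T be - sg * z_sol x) / x ^+ 2 - (T x - T be) / be ^+ 2.
    rewrite /w_sol inv_sqr_maxE; last by rewrite (le_trans s0al)// ltW.
    by rewrite /m; ring.
  (* The bound [zx] makes the first quotient at least [(T x - T be) / x ^+ 2], and [x <= be] allows
     [x] to be replaced by [be] in the denominator. *)
  rewrite subr_ge0; apply: (@le_trans _ _ ((T x - T be) / x ^+ 2)).
    rewrite ler_wpM2l ?subr_ge0 ?T_le ?ltW//.
    by rewrite ltf_pV2 ?posrE ?exprn_gt0// ltrXn2r// ?ltW.
  by rewrite ler_wpM2r ?invr_ge0 ?sqr_ge0//; lra.
have be2 : 0 < be ^- 2 by rewrite invr_gt0 exprn_gt0.
(* Divided by [be ^+ 2], the moment exceeds [k * T be / al]. The terms [k * T be / be] of [Psi_le]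
   and [Wbe] cancel, so the strict sign survives. *)
have := lt_moment; rewrite -(ltr_pM2l be2).
have -> : be ^- 2 * (k * (be ^+ 2 / al) * T be) = k * T be / al.
  by field; rewrite !gt_eqF.
rewrite mulrBr; lra.
Qed.

End solution.

(** * Passage between the half-line and the whole line *)

Section restriction.
Context {R : realType}.
Implicit Types f g : R -> R.

(** [Num.max s0] is a continuous retraction of the line onto the half-line, so one-sided continuity
    at [s0] suffices. *)
Lemma continuous_comp_max f (s0 : R) : {within `[s0, +oo[, continuous f} ->
  continuous (fun s => f (Num.max s0 s)).
Proof.
move=> /subspace_continuousP cf x.
have max_ge y : s0 <= Num.max s0 y by rewrite le_max lexx.
have fx : f @ within `[s0, +oo[ (nbhs (Num.max s0 x)) --> f (Num.max s0 x).
  by apply: cf; rewrite /= in_itv/= andbT.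
have cm : {for x, continuous (cst s0 \max (@id R))}.
  by apply: continuous_max; [exact: cvg_cst|exact: cvg_id].
have mx : Num.max s0 y @[y --> x] --> within `[s0, +oo[ (nbhs (Num.max s0 x)).
  move=> B /cm; apply: (@filterS _ (nbhs x) _
    (fun y => `[s0, +oo[%classic (Num.max s0 y) -> B (Num.max s0 y))) => y; apply.
  by rewrite /= in_itv/= andbT; exact: max_ge.
exact: cvg_comp mx fx.
Qed.

(** Restricting the two-sided difference quotient of an extension [g] to [D] yields in particular
    the one-sided derivative at [s0]. *)
Lemma is_derive_has_derivative_within (D : set R) f g (x l : R) :
  is_derive x 1 g l -> {in D, f =1 g} -> D x -> has_derivative_within D f x l.
Proof.
move=> [dg <-] fg Dx; apply/cvgrPdist_lt => e e0.
have /cvgrPdist_lt/(_ e e0) := dg.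
rewrite /dnbhs !near_withinE => /nbhs_ballP[d /= d0 gd].
apply/nbhs_ballP; exists d => // t xt tx Dt /=.
rewrite !fg ?inE//.
have := gd (t - x); rewrite /ball/= sub0r normrN -(opprB x t) normrN.
move=> /(_ xt); rewrite opprB subr_eq0 => /(_ tx).
by rewrite /GRing.scale/= mulr1 subrK mulrC.
Qed.

End restriction.

(** * Assembly: oscillation, the differential equation and the limit *)

Theorem mainTheorem1 (R : realType) (s0 : R) (p q : R -> R) (a : nat -> R)
    (z h : R -> R)
    (s0_gt0 : 0 < s0)
    (p_cont : {within `[s0, +oo[, continuous p})
    (q_cont : {within `[s0, +oo[, continuous q})
    (p_ge0 : forall s, s0 <= s -> 0 <= p s)
    (p_L1 : (@lebesgue_measure R).-integrable `]s0, +oo[ (EFin \o p))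
    (q_L1 : (@lebesgue_measure R).-integrable `]s0, +oo[ (EFin \o q))
    (a_ge : forall m, (1 <= m)%N -> s0 <= a m)
    (a_incr : forall m n, (1 <= m)%N -> (m < n)%N -> a m < a n)
    (a_unbounded : forall M : R, exists2 m, (1 <= m)%N & M < a m)
    (q_neg : forall m, (1 <= m)%N ->
       forall s, a (2 * m)%N < s < a (2 * m + 1)%N -> q s < 0)
    (q_pos : forall m, (1 <= m)%N ->
       forall s, a (2 * m + 1)%N < s < a (2 * m + 2)%N -> 0 < q s)
    (int_neg : forall m, (1 <= m)%N ->
       \int[lebesgue_measure]_(s in `[a (2 * m)%N, a (2 * m + 1)%N]) `|q s|
       > 3 * \int[lebesgue_measure]_(s in `[a (2 * m + 1)%N, a (2 * m + 2)%N])
               q s)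
    (int_pos : forall m, (1 <= m)%N ->
       \int[lebesgue_measure]_(s in `[a (2 * m + 1)%N, a (2 * m + 2)%N]) q s
       > 2 * \int[lebesgue_measure]_(s in `[a (2 * m + 2)%N, +oo[) `|q s|)
    (moment_neg : \forall m \near \oo,
       \int[lebesgue_measure]_(s in `[a (2 * m)%N, a (2 * m + 1)%N])
         ((s - a (2 * m)%N) * `|q s|)
       > 6 * (a (2 * m + 1)%N ^+ 2 / a (2 * m)%N)
         * \int[lebesgue_measure]_(s in `[a (2 * m + 1)%N, +oo[) `|q s|)
    (moment_pos : \forall m \near \oo,
       \int[lebesgue_measure]_(s in `[a (2 * m + 1)%N, a (2 * m + 2)%N])
         ((s - a (2 * m + 1)%N) * q s)
       > 4 * (a (2 * m + 2)%N ^+ 2 / a (2 * m + 1)%N)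
         * \int[lebesgue_measure]_(s in `[a (2 * m + 2)%N, +oo[) `|q s|)
    (z_def : forall s, s0 <= s ->
       z s = expR (- \int[lebesgue_measure]_(t in `[s0, s]) p t)
             * \int[lebesgue_measure]_(t in `[s, +oo[)
                 (q t * expR (\int[lebesgue_measure]_(x in `[s0, t]) p x)))
    (h_def : forall s, s0 <= s ->
       h s = - s * \int[lebesgue_measure]_(t in `[s, +oo[) (z t / t ^+ 2)) :
  [/\ oscillatory s0 h, is_solution s0 p q h & h s @[s --> +oo] --> (0 : R)].
Proof.
pose pe s := p (Num.max s0 s); pose qe s := q (Num.max s0 s).
have peE s : s0 <= s -> pe s = p s by rewrite /pe => /max_idPr ->.
have qeE s : s0 <= s -> qe s = q s by rewrite /qe => /max_idPr ->.
have cp : continuous pe by exact: continuous_comp_max.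
have cq : continuous qe by exact: continuous_comp_max.
have pe_ge0 s : 0 <= pe s by apply: p_ge0; rewrite le_max lexx.
have itv_ge s : `]s0, +oo[%classic s -> s0 <= s.
  by rewrite /= in_itv/= andbT => /ltW.
have ip : tail_integrable pe.
  apply: (@tail_integrable_obnd _ _ s0) => //; apply: eq_integrable p_L1 => // x.
  by rewrite inE => /itv_ge xs0 /=; rewrite peE.
have iq : tail_integrable qe.
  apply: (@tail_integrable_obnd _ _ s0) => //; apply: eq_integrable q_L1 => // x.
  by rewrite inE => /itv_ge xs0 /=; rewrite qeE.
have int_p s : s0 <= s ->
    \int[lebesgue_measure]_(t in `[s0, s]) p t = tail pe s0 - tail pe s.
  move=> s0s; rewrite tailB//; apply: eq_Rintegral => x.
  by rewrite inE/= in_itv/= => /andP[s0x _]; rewrite peE.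
pose Z := z_sol pe qe; pose W := tail (w_sol pe qe s0).
have zE s : s0 <= s -> z s = Z s.
  move=> s0s; rewrite z_def// int_p// /Z /z_sol.
  (* The inner weight is [expR (tail pe s0) * expR (- tail pe t)]; its constant factor then cancels
     against the outer exponential, so normalising at [+oo] leaves [z] unchanged. *)
  have -> : \int[lebesgue_measure]_(t in `[s, +oo[)
      (q t * expR (\int[lebesgue_measure]_(x in `[s0, t]) p x)) =
      expR (tail pe s0) * tail (weighted_q pe qe) s.
    rewrite -tailZ; last exact: tail_integrable_weighted_q.
    apply: eq_Rintegral => x; rewrite inE/= in_itv/= andbT => sx.
    have s0x := le_trans s0s sx.
    by rewrite int_p// expRD /weighted_q qeE//; ring.
  by rewrite mulrA -expRD; congr (expR _ * _); ring.
have hE s : s0 <= s -> h s = h_sol pe qe s0 s.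
  move=> s0s; rewrite h_def// /h_sol; congr (_ * _).
  apply: eq_Rintegral => x; rewrite inE/= in_itv/= andbT => sx.
  have s0x := le_trans s0s sx.
  by rewrite zE// /w_sol inv_sqr_maxE.
have dh x : is_derive x (1 : R) (h_sol pe qe s0) (- W x + x * w_sol pe qe s0 x).
  exact: is_derive_h_sol.
have tail_normq s : s0 <= s ->
    \int[lebesgue_measure]_(t in `[s, +oo[) `|q t| = tail (fun t => `|qe t|) s.
  move=> s0s; apply: eq_Rintegral => x; rewrite inE/= in_itv/= andbT => sx.
  by rewrite qeE// (le_trans s0s).
have gt0 s : s0 <= s -> 0 < s by exact: lt_le_trans.
split.
- split.
    apply: (@subspace_eq_continuous _ _ _ (h_sol pe qe s0)).
      by move=> x; rewrite inE/= in_itv/= andbT => s0x; exact/esym/hE.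
    by apply: continuous_subspaceT => x; exact: is_derive_continuous (dh x).
  move=> M.
  (* The limit is 1, and 4 is the smaller of the moment constants 4 and 6, so one threshold serves
     both signs. *)
  have expA_le4 : \forall s \near +oo, expR (tail pe s) <= 4.
    have : expR (tail pe s) @[s --> +oo] --> expR 0.
      by apply: continuous_cvg; [exact: continuous_expR|exact: tail_cvg0].
    rewrite expR0 => /cvgr_le; apply; lra.
  have [S [_ HS]] := expA_le4.
  have [N _ HN] := filterI moment_neg moment_pos.
  have [m0 m0_gt0 am0] := a_unbounded (Num.max M S).
  pose m := maxn m0 N.
  have m_gt0 : (1 <= m)%N by rewrite leq_max m0_gt0.
  have [mneg mpos] : _ /\ _ := HN m (leq_maxr _ _).
  have a_gt n : (m <= n)%N -> Num.max M S < a n.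
    move=> mn; have : (m0 <= n)%N by rewrite (leq_trans (leq_maxl _ _) mn).
    rewrite leq_eqVlt => /predU1P[<-//|m0n].
    by rewrite (lt_trans am0)// a_incr.
  have m2 : (m <= 2 * m)%N by rewrite leq_pmull.
  have m21 : (m <= 2 * m + 1)%N by rewrite (leq_trans m2)// leq_addr.
  (* Both signs are treated at once: [sg] is opposite to the sign of [q] between [a n] and [a n'],
     and [k >= 4] bounds the exponential at [a n]. *)
  have moment (sg k : R) n n' : `|sg| = 1 -> 4 <= k -> (m <= n)%N -> (n < n')%N ->
    (forall s, a n < s < a n' -> `|q s| = - (sg * q s)) ->
    k * (a n' ^+ 2 / a n) * (\int[lebesgue_measure]_(s in `[a n', +oo[) `|q s|) <
      \int[lebesgue_measure]_(s in `[a n, a n']) ((s - a n) * `|q s|) ->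
    [/\ s0 <= a n, M < a n & sg * W (a n) < 0].
  { move=> sg1 k4 mn nn' qsg.
    have n_gt0 : (0 < n)%N by exact: leq_trans mn.
    have s0n : s0 <= a n by exact: a_ge.
    have ann' : a n < a n' by exact: a_incr.
    have := a_gt _ mn; rewrite gt_max => /andP[Mn Sn].
    rewrite tail_normq; last by rewrite (le_trans s0n)// ltW.
    move=> lt_moment; split => //.
    apply: (@sg_tail_w_sol_lt0 _ pe qe s0 _ _ _ _ _ _ sg k (a n) (a n')) => //.
    - by rewrite (le_trans _ k4)// HS.
    - move=> s sn; rewrite qeE; first exact: qsg.
      by move: sn => /andP[/ltW + _]; exact: le_trans.
    - move: lt_moment; congr (_ < _); apply: eq_Rintegral => x.
      rewrite inE/= in_itv/= => /andP[nx _].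
      by rewrite qeE// (le_trans s0n). }
  split.
  + exists (a (2 * m)%N).
    have [||||||s0a Ma] := moment 1 6 (2 * m)%N (2 * m + 1)%N.
    * exact: normr1.
    * by lra.
    * by [].
    * by rewrite addn1.
    * by move=> s /(q_neg _ m_gt0) qs; rewrite mul1r ltr0_norm.
    * exact: mneg.
    rewrite mul1r => Wa; split => //.
    by rewrite hE// /h_sol mulNr -mulrN pmulr_rgt0 ?oppr_gt0// gt0.
  + exists (a (2 * m + 1)%N).
    have [||||||s0a Ma] := moment (-1) 4 (2 * m + 1)%N (2 * m + 2)%N.
    * by rewrite normrN1.
    * by lra.
    * by [].
    * by rewrite ltn_add2l.
    * by move=> s /(q_pos _ m_gt0) qs; rewrite mulN1r opprK gtr0_norm.
    (* This moment hypothesis involves [q] rather than [|q|]. Comparing by [q <= |q|] avoids the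
       sign of [q] at the endpoints, but needs both integrands integrable. *)
    * apply: lt_le_trans mpos _.
      set al := a _; set be := a _.
      have s0al : s0 <= al by apply: a_ge; rewrite (leq_trans m_gt0).
      have int_moment (g ge : R -> R) : continuous ge ->
          (forall s, s0 <= s -> ge s = g s) ->
          (@lebesgue_measure R).-integrable `[al, be]
            (EFin \o (fun s => (s - al) * g s)).
        move=> cg gE.
        have : (@lebesgue_measure R).-integrable `[al, be]
            (EFin \o (fun s => (s - al) * ge s)).
          apply: continuous_integrable_itvcc => s; apply: cvgM; last exact: cg.
          by apply: cvgB; [exact: cvg_id|exact: cvg_cst].
        apply: eq_integrable => // s.
        rewrite inE/= in_itv/= => /andP[als _].
        by rewrite gE// (le_trans s0al).
      apply: le_Rintegral => //.
      - exact: int_moment cq qeE.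
      - apply: (int_moment _ (fun s => `|qe s|)).
          by move=> s; apply: cvg_norm; exact: cq.
        by move=> s s0s; rewrite qeE.
      - move=> s /=; rewrite in_itv/= => /andP[als _].
        by rewrite ler_wpM2l ?subr_ge0// ler_norm.
    rewrite mulN1r oppr_lt0 => Wa; split => //.
    by rewrite hE// /h_sol mulNr oppr_lt0 mulr_gt0// gt0.
(* Since [h = - s * W] and [W' = - Z / s ^+ 2], one gets [h' = - W + Z / s]; in [h''] the two terms
   [Z / s ^+ 2] cancel, leaving [Z' / s]. *)
- exists (fun s => - W s + Z s * s^-1), (fun s => - (pe s * Z s + qe s) * s^-1).
  split.
  + move=> s s0s; apply: (@is_derive_has_derivative_within _ _ _ (h_sol pe qe s0)).
    * apply: is_derive_eq (dh s) _.
      rewrite /w_sol inv_sqr_maxE// -/(Z s); congr (_ + _).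
      by field; rewrite gt_eqF// gt0.
    * by move=> x; rewrite inE/= in_itv/= andbT => s0x; rewrite hE.
    * by rewrite /= in_itv/= andbT.
  + move=> s s0s.
    apply: (@is_derive_has_derivative_within _ _ _
      (fun s => - W s + Z s * s^-1)) => //; last first.
      by rewrite /= in_itv/= andbT.
    have s_neq0 : s != 0 by rewrite gt_eqF// gt0.
    have dZ : is_derive s 1 Z (- (pe s * Z s + qe s)) by exact: is_derive_z_sol.
    have dW : is_derive s 1 W (- w_sol pe qe s0 s).
      apply: is_derive_tail; first exact: continuous_w_sol.
      exact: tail_integrable_w_sol.
    apply: is_derive_eq (is_deriveD (is_deriveN dW)
      (is_deriveM dZ (is_derive_inv s s_neq0))) _.
    rewrite /w_sol inv_sqr_maxE// -/(Z s) /GRing.scale/=.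
    by field.
  + apply: continuous_in_subspaceT => x; rewrite inE/= in_itv/= andbT => s0x.
    apply: cvgM; last by apply: cvgV; [rewrite gt_eqF// gt0|exact: cvg_id].
    apply: cvgN; apply: cvgD; last exact: cq.
    by apply: cvgM; [exact: cp|exact: continuous_z_sol].
  + move=> s s0s; rewrite hE// /h_sol peE// qeE// -/(W s).
    by field; rewrite gt_eqF// gt0.
- apply: cvg_trans (cvg_h_sol pe qe s0 s0_gt0 pe_ge0 cp cq ip iq).
  apply: near_eq_cvg; near=> s.
  have s0s : s0 <= s by near: s; apply: nbhs_pinfty_ge; exact: num_real.
  by rewrite hE.
Unshelve. all: by end_near. Qed.
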